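(* The pattern $\{(1,2),(2,1),(1,3),(3,1),(2,3),(3,2)\}$ is not $4$-universal.
   Context: Let $L(4)$ be the space of traceless complex $4\times4$ matrices. For a set $I\subseteq\{1,2,3,4\}^2$, let $L_I(4)$ be the subspace of all $X=[x_{ij}]\in L(4)$ with $x_{ij}=0$ for all $(i,j)\in I$. The pattern $I$ is $4$-universal if every matrix in $L(4)$ is unitarily similar (by an element of $\mathrm{U}(4)$) to a matrix in $L_I(4)$. *)

(* Defs.v *)
From HB Require Import structures.
From mathcomp Require Import all_boot all_order all_algebra.

Set Implicit Arguments.
Unset Strict Implicit.
Unset Printing Implicit Defensive.

Import GRing.Theory Num.Theory.
Local Open Scope ring_scope.

(* The scalars C are kept abstract, to be instantiated with R[i] for
   R : realType; [unitarymx] needs a numClosedFieldType. *)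
Section UniversalPatterns.
Context (C : numClosedFieldType) (n : nat).

Definition traceless : pred 'M[C]_n := [pred X | \tr X == 0].

Definition traceless_pattern (I : {set 'I_n * 'I_n}) : pred 'M[C]_n :=
  [pred X in traceless | [forall p in I, X p.1 p.2 == 0]].

(* [similar_in unitarymx A X]: X = P A P^-1 for some unitary P, where P^-1 is
   the conjugate transpose of P (see [conjymx]). *)
Definition universal (I : {set 'I_n * 'I_n}) : Prop :=
  forall A : 'M[C]_n, A \in traceless ->
    exists2 X : 'M[C]_n,
      X \in traceless_pattern I & similar_in (@unitarymx C n n) A X.

End UniversalPatterns.

(* Indices are 0-based: 0, 1, 2 : 'I_4 stand for 1, 2, 3 in {1, 2, 3, 4}. *)
Definition leading_offdiag_pattern : {set 'I_4 * 'I_4} :=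
  [set (0, 1); (1, 0); (0, 2); (2, 0); (1, 2); (2, 1)].

(* Main.v *)
(** Let X = P A P^* with P unitary and with X diagonal on its leading 3x3 block.
    Three linear conditions leave a nonzero row vector x such that x and x X
    vanish at the last index and y = x P vanishes at the last index. The
    diagonal block makes |(x X)_j| and |(x X^* )_j| agree on the first three
    indices, so |x X| <= |x X^*|, that is, |y A| <= |y A^*|. For the weighted
    shift A with weights 1, 2, 3, the self-commutator A A^* - A^* A is
    diag(1, 3, 5, -9), so |y A| > |y A^*|: a contradiction. *)
Require Import Defs.
From mathcomp Require Import all_boot all_order all_algebra.
From mathcomp Require Import reals complex.
From mathcomp Require Import ring.

Set Implicit Arguments.
Unset Strict Implicit.
Unset Printing Implicit Defensive.

Import Order.TTheory GRing.Theory Num.Theory.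
Local Open Scope ring_scope.
Local Open Scope sesquilinear_scope.

Lemma exists_row_ortho (F : fieldType) (m n : nat) (M : 'M[F]_(m, n)) :
  (n < m)%N -> exists2 x : 'rV[F]_m, x != 0 & x *m M = 0.
Proof.
move=> lt_nm.
have /rowV0Pn[x /sub_kermxP xM x0] : kermx M != 0.
  rewrite kermx_eq0 -row_leq_rank -ltnNge.
  exact: leq_ltn_trans (rank_leq_col M) lt_nm.
by exists x.
Qed.

Section SelfCommutator.
Variable C : numClosedFieldType.

Lemma dotmx_sum_sqr n (u : 'rV[C]_n) : dotmx u u = \sum_j `|u 0 j| ^+ 2.
Proof.
by rewrite dotmxE mxE; apply: eq_bigr => j _; rewrite !mxE normCK.
Qed.

Lemma dotmx_mul_unitary n (u : 'rV[C]_n) (P : 'M[C]_n) :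
  P \is unitarymx -> dotmx (u *m P) (u *m P) = dotmx u u.
Proof.
by move=> Pu; rewrite !dotmxE trmx_mul map_mxM mulmxA mulmxtVK.
Qed.

Lemma sum_ord4 (f : 'I_4 -> C) : \sum_i f i = f 0 + f 1 + f 2 + f 3.
Proof.
rewrite !big_ord_recl big_ord0 addr0 !addrA.
by congr (f _ + f _ + f _ + f _); apply: val_inj.
Qed.

Lemma pattern_norm_le (X : 'M[C]_4) (x : 'rV[C]_4) :
  X \in traceless_pattern leading_offdiag_pattern ->
  x 0 3 = 0 -> (x *m X) 0 3 = 0 ->
  dotmx (x *m X) (x *m X) <= dotmx (x *m X^t*) (x *m X^t*).
Proof.
move=> /andP[_ /forall_inP X0] x3 xX3.
have E i j : (i, j) \in leading_offdiag_pattern -> X i j = 0.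
  by move=> /X0 /eqP.
rewrite !dotmx_sum_sqr !sum_ord4 xX3 normr0 expr0n addr0.
rewrite !mxE !sum_ord4 !mxE x3 !mul0r !addr0.
rewrite !(E 0 1, E 1 0, E 0 2, E 2 0, E 1 2, E 2 1) ?inE ?eqxx ?orbT //.
rewrite !(conjC0, mulr0, addr0, add0r).
(* The first three terms agree in modulus; what remains on the right is the squared modulus of the
   last entry of [x *m X^t*]. *)
by rewrite !normrM !norm_conjC lerDl exprn_ge0.
Qed.

(** The weight is the 0-based column index, so the superdiagonal reads 1, 2, ..., n-1. *)
Definition weighted_shift n : 'M[C]_n :=
  \matrix_(i, j) if j == i.+1 :> nat then j%:R else 0.

Lemma weighted_shift_traceless n : weighted_shift n \in (@traceless C n).
Proof.
rewrite inE; apply/eqP; apply: big1 => i _.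
by rewrite mxE ltn_eqF.
Qed.

(** With [y 0 3 = 0] the self-commutator gives the difference |y_0|^2 + 3|y_1|^2 + 5|y_2|^2, which
    is at least |y|^2 > 0. *)
Lemma weighted_shift_norm_lt (y : 'rV[C]_4) :
  y != 0 -> y 0 3 = 0 ->
  dotmx (y *m (weighted_shift 4)^t*) (y *m (weighted_shift 4)^t*) <
  dotmx (y *m weighted_shift 4) (y *m weighted_shift 4).
Proof.
move=> y0 y3; rewrite -subr_gt0.
have y_gt0 : 0 < `|y 0 0| ^+ 2 + `|y 0 1| ^+ 2 + `|y 0 2| ^+ 2.
  have := dotmx_is_dotmx y0.
  by rewrite dotmx_sum_sqr sum_ord4 y3 normr0 expr0n addr0.
apply: lt_le_trans y_gt0 _.
rewrite !dotmx_sum_sqr !sum_ord4 !mxE !sum_ord4 !mxE y3 /=.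
rewrite !conjC0 !conjC_nat !(mulr0, mul0r, addr0, add0r, mulr1, normr0).
rewrite !normrM !normr_nat expr0n /= !modn_small //.
rewrite -subr_ge0.
set a : C := `|y 0 1|; set b : C := `|y 0 2|.
rewrite (_ : _ - _ = 2 * a ^+ 2 + 4 * b ^+ 2); last by ring.
by rewrite addr_ge0 // mulr_ge0 ?exprn_ge0 ?normr_ge0 ?ler0n.
Qed.

Lemma leading_offdiag_not_universal : ~ universal C leading_offdiag_pattern.
Proof.
move=> /(_ _ (weighted_shift_traceless 4)) [X Xpat [P Pu]].
set A := weighted_shift 4 => XE.
have {}XE : X = P *m A *m P^t*.
  by rewrite -conjymx //; apply/esym/eqP.
have XtE : X^t* = P *m A^t* *m P^t*.
  by rewrite XE !trmx_mul !map_mxM /= trmxCK mulmxA.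
(* The columns of [M] are the functionals x_3, (x X)_3 and (x P)_3; four rows exceed three columns,
   so some nonzero x kills all three. *)
pose M : 'M[C]_(4, 1 + (1 + 1)) :=
  row_mx (col 3 1%:M) (row_mx (col 3 X) (col 3 P)).
have [//|x x0] := @exists_row_ortho _ _ _ M.
rewrite /M !mul_mx_row !colE !mulmxA mulmx1 -!colE.
move=> /eqP; rewrite -row_mx0 -[X in row_mx 0 X]row_mx0.
move=> /eqP/eq_row_mx[x3 /eq_row_mx[xX3 y3]].
have {x3 xX3 y3} [x3 xX3 y3] : [/\ x 0 3 = 0, (x *m X) 0 3 = 0 & (x *m P) 0 3 = 0].
  by move: x3 xX3 y3; do 3![move=> /matrixP/(_ 0 0); rewrite mxE [RHS]mxE => ?].
have y0 : x *m P != 0.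
  apply: contra x0 => /eqP xP0.
  by rewrite -(mulmxtVK x Pu) xP0 mul0mx.
have := weighted_shift_norm_lt y0 y3.
have Ptu : P^t* \is unitarymx by rewrite trmxC_unitary.
(* Multiplying by [P^t*] on the right preserves norms and turns x P A into x X, and x P A^* into x
   X^*. *)
rewrite -(dotmx_mul_unitary _ Ptu) -[ltRHS](dotmx_mul_unitary _ Ptu) -!mulmxA.
rewrite !(mulmxA P) -XE -XtE.
by move=> /lt_geF; rewrite pattern_norm_le.
Qed.

End SelfCommutator.

Theorem proposition7p1 (R : realType) :
  ~ universal R[i] leading_offdiag_pattern.
Proof.
exact: leading_offdiag_not_universal.
Qed.
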